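(* Let $q\in\mathbb{C}$ with $|q|<1$. Then $$1-\sum_{n=1}^\infty q^{n(3n-1)/2}(1-q^n)=\cfrac{2}{2+q+\cfrac{q-q^3}{1+q^3+\cfrac{q^2+q^3}{1+q^5+\cfrac{q^5-q^9}{1+q^7+\cfrac{q^4+q^7}{1+q^9+\cfrac{q^9-q^{15}}{1+q^{11}+\cfrac{q^6+q^{11}}{1+q^{13}+\cdots}}}}}}},$$ i.e. the left side equals $\cfrac{2}{b_0+\cfrac{a_1}{b_1+\cfrac{a_2}{b_2+\cdots}}}$ with $b_0=2+q$, $b_k=1+q^{2k+1}$ for $k\ge1$, and $a_{2n-1}=q^{4n-3}-q^{6n-3}$, $a_{2n}=q^{2n}+q^{4n-1}$ for $n\ge1$.
   Context: For complex sequences with all partial numerators $a_k\neq0$ (so $q\neq0$ here), an infinite continued fraction has value $f\in\mathbb{C}\cup\{\infty\}$ if its finite truncations (approximants) $\cfrac{2}{b_0+\cfrac{a_1}{b_1+\cdots+\cfrac{a_n}{b_n}}}$ converge to $f$ as $n\to\infty$. *)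

(* Defs.v *)
From Stdlib Require Import Reals.
From Coquelicot Require Import Coquelicot.

Local Open Scope C_scope.

(* The extended complex plane: [None] is the point at infinity. *)
Definition Cbar : Type := option C.

Definition Cbar_locally (z : Cbar) : (Cbar -> Prop) -> Prop :=
  match z with
  | Some w => filtermap Some (locally w)
  | None => fun P => P None /\ exists M : R, forall w : C, (M < Cmod w)%R -> P (Some w)
  end.

Definition Cbar_shift (b : C) (z : Cbar) : Cbar := option_map (Cplus b) z.

(* [a / z], only meaningful for [a <> 0]: then [a / 0] is infinite and
   [a] divided by infinity is [0]. *)
Definition Cbar_quot (a : C) (z : Cbar) : Cbar :=
  match z with
  | Some w => if Ceq_dec w 0 then None else Some (a / w)
  | None => Some (RtoC 0)
  end.

(* b_k + a_(k+1) / (b_(k+1) + ... + a_(k+n) / b_(k+n)) *)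
Fixpoint cf_tail (a b : nat -> C) (k n : nat) : Cbar :=
  match n with
  | O => Some (b k)
  | S m => Cbar_shift (b k) (Cbar_quot (a (S k)) (cf_tail a b (S k) m))
  end.

(* c / (b_0 + a_1 / (b_1 + ... + a_n / b_n)); the entry [a 0] is never used. *)
Definition cf_approximant (c : C) (a b : nat -> C) (n : nat) : Cbar :=
  Cbar_quot c (cf_tail a b 0 n).

Definition cf_has_value (c : C) (a b : nat -> C) (f : Cbar) : Prop :=
  c <> 0 /\ (forall k, (1 <= k)%nat -> a k <> 0) /\
  filterlim (cf_approximant c a b) eventually (Cbar_locally f).

(* Main.v *)
(* Write (x; p)_k for the finite product of the 1 - x p^i, i < k.  The recurrence
   F_k = b_k F_(k+1) + a_(k+1) F_(k+2) of the continued fraction is solved by the bounded sequence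
     F_(2n)   = sum_k q^(k^2+4nk)    (-q^2;q^2)_k / ((1+q^(2k)) (q^2;q^2)_k (-q^2;q^2)_(n+k))   (n >= 1),
     F_(2n+1) = sum_k q^(k^2+2k+4nk) (-q^2;q^2)_k / ((1+q^(2k)) (q^2;q^2)_k (-q^2;q^2)_(n+k)),
     F_0 = sum_k q^(k^2) / (q^2;q^2)_k,
   each relation being a telescoping sum over k.  As the a_k decay geometrically, the continued
   fraction then converges to 2 F_1 / F_0.

   Let E_m = sum_k q^(k^2+2mk) / (q^2;q^2)_k and let T_(n,m) be the same sum with the k-th term
   multiplied by q^(2k) / (1+q^(2n+2k)), so that F_0 = E_0 and F_1 = T_(0,0).  Moving along the
   diagonal n = m expands 2 F_1 / F_0 into the series H_0, where
     H_n = sum_j (-1)^j q^(j(j+1)/2 + 2nj) / (-q^(n+1);q)_j,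
   and H_n = 1 - q^(2n+1) + q^(3n+2) H_(n+1) unrolls H_0 into Rogers' false theta series 1 - s. *)
Require Import Defs.
From Stdlib Require Import Reals Lra Lia.
From Coquelicot Require Import Coquelicot.

Local Open Scope C_scope.

(** * Complex sequences of geometric decay *)

(** The ratio is explicit, and later always |q|, so that sequences with the same [r] can be added
    and compared without choosing a common rate. *)
Definition geo (r : R) (u : nat -> C) : Prop :=
  exists M : R, forall n, (Cmod (u n) <= M * r ^ n)%R.

Lemma filterlim_C_ball (u : nat -> C) (l : C) :
  filterlim u eventually (locally l) <->
  forall eps : posreal, eventually (fun n => (Cmod (u n - l) < eps)%R).
Proof.
  exact (@filterlim_locally_ball_norm _ nat C_NormedModule _ _ u l).
Qed.

Lemma geo_eventually_small (r : R) (u : nat -> C) (eps : R) :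
  (0 <= r < 1)%R -> geo r u -> (0 < eps)%R ->
  eventually (fun n => (Cmod (u n) < eps)%R).
Proof.
  intros Hr [M HM] He.
  (* [Rabs M + 1] is a positive divisor whatever the sign of [M]. *)
  destruct (pow_lt_1_zero r) with (y := (eps / (Rabs M + 1))%R) as [N HN].
  - rewrite Rabs_pos_eq; lra.
  - apply Rdiv_lt_0_compat; [exact He | pose proof (Rabs_pos M); lra].
  - exists N; intros n Hn.
    specialize (HN n Hn).
    assert (Hp : (0 <= r ^ n)%R) by (apply pow_le; lra).
    rewrite Rabs_pos_eq in HN by exact Hp.
    apply Rle_lt_trans with (1 := HM n).
    pose proof (Rabs_pos M) as HM0.
    apply Rle_lt_trans with ((Rabs M + 1) * r ^ n)%R.
    + apply Rmult_le_compat_r; [exact Hp | pose proof (Rle_abs M); lra].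
    + apply Rmult_lt_compat_l with (r := (Rabs M + 1)%R) in HN; [| lra].
      replace (eps)%R with ((Rabs M + 1) * (eps / (Rabs M + 1)))%R by (field; lra).
      exact HN.
Qed.

Lemma geo_filterlim (r : R) (u : nat -> C) (l : C) :
  (0 <= r < 1)%R -> geo r (fun n => u n - l) -> filterlim u eventually (locally l).
Proof.
  intros Hr Hu; apply filterlim_C_ball; intros eps.
  apply (geo_eventually_small r (fun n => u n - l)); [exact Hr | exact Hu | apply cond_pos].
Qed.

Lemma geo_plus (r : R) (u v : nat -> C) :
  geo r u -> geo r v -> geo r (fun n => u n + v n).
Proof.
  intros [M H] [M' H']; exists (M + M')%R; intros n.
  apply Rle_trans with (1 := Cmod_triangle _ _).
  rewrite Rmult_plus_distr_r; apply Rplus_le_compat; auto.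
Qed.

Lemma geo_mult_bounded (r B : R) (u v : nat -> C) :
  (0 <= r)%R -> (forall n, (Cmod (u n) <= B)%R) -> geo r v ->
  geo r (fun n => u n * v n).
Proof.
  intros Hr Hu [M H]; exists (B * M)%R; intros n.
  rewrite Cmod_mult, Rmult_assoc.
  apply Rmult_le_compat; auto using Cmod_ge_0.
Qed.

Lemma pow_le_pow_base_lt1 (r : R) (m n : nat) :
  (0 <= r <= 1)%R -> (m <= n)%nat -> (r ^ n <= r ^ m)%R.
Proof.
  intros Hr Hmn.
  replace n with (m + (n - m))%nat by lia; rewrite pow_add.
  rewrite <- (Rmult_1_r (r ^ m)) at 2.
  apply Rmult_le_compat_l; [apply pow_le; lra |].
  rewrite <- (pow1 (n - m)); apply pow_incr; lra.
Qed.

Lemma geo_pow (q : C) (e : nat -> nat) :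
  (Cmod q < 1)%R -> (forall n, (n <= e n)%nat) -> geo (Cmod q) (fun n => q ^ e n).
Proof.
  intros Hq He; exists 1%R; intros n; rewrite Cmod_pow, Rmult_1_l.
  apply pow_le_pow_base_lt1; [pose proof (Cmod_ge_0 q); lra | apply He].
Qed.

(** * Complex series: evaluation, bounds, telescoping *)

Lemma is_series_C_unique (a : nat -> C) (l l' : C) :
  is_series a l -> is_series a l' -> l = l'.
Proof. apply filterlim_locally_unique. Qed.

Lemma sum_n_C_0 (a : nat -> C) : sum_n a 0 = a 0%nat :> C.
Proof. exact (sum_O a). Qed.

Lemma sum_n_C_S (a : nat -> C) (n : nat) : sum_n a (S n) = sum_n a n + a (S n) :> C.
Proof. exact (sum_Sn a n). Qed.

(** The sequence [e] is a candidate for the tails of the series: the recurrence makes the partial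
    sums equal to [l - e (S n)], and decay of [e] does the rest. A series is thus evaluated from
    algebra on its tails. *)
Lemma is_series_remainder (r : R) (a e : nat -> C) (l : C) :
  (0 <= r < 1)%R -> e 0%nat = l -> (forall n, e n = a n + e (S n)) -> geo r e ->
  is_series a l.
Proof.
  intros Hr H0 HS [M He].
  assert (Hs : forall n, sum_n a n = l - e (S n) :> C).
  { induction n as [|n IH].
    - rewrite sum_n_C_0, <- H0, (HS 0%nat); ring.
    - rewrite sum_n_C_S, IH, (HS (S n)); ring. }
  apply (geo_filterlim r); [exact Hr |].
  exists (M * r)%R; intros n; rewrite Hs.
  replace (l - e (S n) - l) with (- e (S n)) by ring.
  rewrite Cmod_opp, Rmult_assoc; apply (He (S n)).
Qed.

(** A total function, so that sums can be written before convergence is known; [CSum_correct] makes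
    it the actual sum for terms of geometric decay. *)
Definition CSum (a : nat -> C) : C :=
  (Series (fun n => fst (a n)), Series (fun n => snd (a n))).

Lemma fst_sum_n (a : nat -> C) (n : nat) : fst (sum_n a n) = sum_n (fun k => fst (a k)) n.
Proof.
  induction n as [|n IH]; [now rewrite !sum_O |].
  rewrite !sum_Sn, <- IH; reflexivity.
Qed.

Lemma snd_sum_n (a : nat -> C) (n : nat) : snd (sum_n a n) = sum_n (fun k => snd (a k)) n.
Proof.
  induction n as [|n IH]; [now rewrite !sum_O |].
  rewrite !sum_Sn, <- IH; reflexivity.
Qed.

Lemma ex_series_geom_dominated (r M : R) (a : nat -> R) :
  (0 <= r < 1)%R -> (forall n, (Rabs (a n) <= M * r ^ n)%R) -> ex_series a.
Proof.
  intros Hr Ha.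
  apply (ex_series_le a (fun n => (M * r ^ n)%R)); [exact Ha |].
  apply (ex_series_scal M (fun n => (r ^ n)%R)).
  apply ex_series_geom; rewrite Rabs_pos_eq; lra.
Qed.

Lemma CSum_correct (r : R) (a : nat -> C) :
  (0 <= r < 1)%R -> geo r a -> is_series a (CSum a).
Proof.
  intros Hr [M Ha].
  assert (H1 : is_series (fun n => fst (a n)) (Series (fun n => fst (a n)))).
  { apply Series_correct, (ex_series_geom_dominated r M); [exact Hr |].
    intros n; apply Rle_trans with (2 := Ha n); apply (re_le_Cmod (a n)). }
  assert (H2 : is_series (fun n => snd (a n)) (Series (fun n => snd (a n)))).
  { apply Series_correct, (ex_series_geom_dominated r M); [exact Hr |].
    intros n; apply Rle_trans with (2 := Ha n).
    apply Rle_trans with (2 := Rmax_Cmod (a n)), Rmax_r. }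
  (* Balls are taken coordinatewise here, so the two real limits combine directly. *)
  apply filterlim_locally; intros eps.
  generalize (proj1 (filterlim_locally _ _) H1 eps) (proj1 (filterlim_locally _ _) H2 eps).
  intros A B; generalize (filter_and _ _ A B).
  apply filter_imp; intros n [P Q].
  rewrite <- fst_sum_n in P; rewrite <- snd_sum_n in Q.
  split; assumption.
Qed.

Lemma is_series_Cmod_le (r M : R) (a : nat -> C) (l : C) :
  (0 <= r < 1)%R -> (forall n, (Cmod (a n) <= M * r ^ n)%R) -> is_series a l ->
  (Cmod l <= M / (1 - r))%R.
Proof.
  intros Hr Ha Hl.
  assert (Hn : is_lim_seq (fun n => Cmod (sum_n a n)) (Cmod l)).
  { apply (filterlim_comp _ _ _ (sum_n a) Cmod eventually (locally l) (locally (Cmod l)) Hl).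
    exact (@filterlim_norm _ C_NormedModule l). }
  refine (is_lim_seq_le _ (fun _ => (M / (1 - r))%R) _ (M / (1 - r))%R _ Hn (is_lim_seq_const _)).
  intros n.
  assert (HM : (0 <= M)%R).
  { specialize (Ha 0%nat); simpl in Ha; pose proof (Cmod_ge_0 (a 0%nat)); lra. }
  assert (Hle : (Cmod (sum_n a n) <= M * (1 - r ^ S n) / (1 - r))%R).
  { induction n as [|n IH].
    - rewrite sum_n_C_0; apply Rle_trans with (1 := Ha 0%nat); right; simpl; field; lra.
    - rewrite sum_n_C_S; apply Rle_trans with (1 := Cmod_triangle _ _).
      replace (M * (1 - r ^ S (S n)) / (1 - r))%R
        with (M * (1 - r ^ S n) / (1 - r) + M * r ^ S n)%R by (simpl; field; lra).
      apply Rplus_le_compat; [exact IH | apply Ha]. }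
  apply Rle_trans with (1 := Hle).
  apply Rmult_le_compat_r; [left; apply Rinv_0_lt_compat; lra |].
  assert (0 <= r ^ S n)%R by (apply pow_le; lra); nra.
Qed.

Lemma CSum_Cmod_le (r M : R) (a : nat -> C) :
  (0 <= r < 1)%R -> (forall n, (Cmod (a n) <= M * r ^ n)%R) ->
  (Cmod (CSum a) <= M / (1 - r))%R.
Proof.
  intros Hr Ha; apply (is_series_Cmod_le r M a); auto.
  apply (CSum_correct r); [exact Hr | now exists M].
Qed.

Lemma CSum_unique (r : R) (a : nat -> C) (l : C) :
  (0 <= r < 1)%R -> geo r a -> is_series a l -> CSum a = l.
Proof.
  intros Hr Ha; apply is_series_C_unique, (CSum_correct r); assumption.
Qed.

(** The common pattern of the recurrences below: a termwise identity up to a difference of a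
    certificate [G]. Since [G] tends to 0, the differences sum to [- G 0]. *)
Lemma CSum_telescope (r : R) (a b c G : nat -> C) (A B : C) :
  (0 <= r < 1)%R -> geo r a -> geo r b -> geo r c -> geo r G ->
  (forall k, a k = A * b k + B * c k + (G (S k) - G k)) ->
  CSum a = A * CSum b + B * CSum c - G 0%nat.
Proof.
  intros Hr Ha Hb Hc HG E.
  apply (CSum_unique r); [exact Hr | exact Ha |].
  assert (HGs : is_series (fun k => G (S k) - G k) (- G 0%nat)).
  { apply (is_series_remainder r _ (fun n => - G n)); [exact Hr | reflexivity | intros; ring |].
    destruct HG as [M HM]; exists M; intros n; rewrite Cmod_opp; apply HM. }
  pose proof (is_series_plus _ _ _ _ 
   (is_series_plus _ _ _ _ 
     (is_series_scal A _ _ (CSum_correct r b Hr Hb))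
     (is_series_scal B _ _ (CSum_correct r c Hr Hc))) HGs) as H.
  revert H; apply is_series_ext; intros n; symmetry; apply E.
Qed.

(** The partial sums of the paired series are the odd-indexed partial sums of the original one. *)
Lemma is_series_pairs (a : nat -> C) (l : C) :
  is_series a l -> is_series (fun n => a (2 * n)%nat + a (2 * n + 1)%nat) l.
Proof.
  intros H.
  assert (E : forall n, sum_n a (2 * n + 1) = sum_n (fun n => a (2 * n)%nat + a (2 * n + 1)%nat) n :> C).
  { induction n as [|n IH].
    - simpl; rewrite sum_n_C_S, !sum_n_C_0; reflexivity.
    - rewrite sum_n_C_S, <- IH.
      replace (2 * S n + 1)%nat with (S (S (2 * n + 1))) by lia.
      rewrite !sum_n_C_S.
      replace (2 * S n)%nat with (S (2 * n + 1)) by lia.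
      ring. }
  unfold is_series.
  apply (filterlim_ext _ _ E).
  apply (filterlim_comp _ _ _ (fun n => (2 * n + 1)%nat) (sum_n a) eventually eventually);
    [| exact H].
  intros P [N HN]; exists N; intros n Hn; apply HN; lia.
Qed.

(** * Discrete Gronwall estimates *)

Lemma exp_geom_sum_le (r c : R) (n : nat) :
  (0 <= r < 1)%R -> (0 <= c)%R ->
  (exp (c * (1 - r ^ n) / (1 - r)) <= exp (c / (1 - r)))%R.
Proof.
  intros Hr Hc.
  assert (H : (c * (1 - r ^ n) / (1 - r) <= c / (1 - r))%R).
  { apply Rmult_le_compat_r; [left; apply Rinv_0_lt_compat; lra |].
    assert (0 <= r ^ n)%R by (apply pow_le; lra); nra. }
  destruct H as [H | ->]; [left; now apply exp_increasing | right; reflexivity].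
Qed.

(** Since 1 + t <= exp t, the product of the factors 1 + c r^i is at most the exponential of a
    geometric sum, bounded by c / (1 - r). *)
Lemma forward_growth (r c : R) (x : nat -> R) :
  (0 <= r < 1)%R -> (0 <= c)%R -> (forall n, (0 <= x n)%R) ->
  (forall n, (x (S n) <= (1 + c * r ^ n) * x n)%R) ->
  forall n, (x n <= x 0%nat * exp (c / (1 - r)))%R.
Proof.
  intros Hr Hc Hx HS n.
  assert (H : (x n <= x 0%nat * exp (c * (1 - r ^ n) / (1 - r)))%R).
  { induction n as [|n IH].
    - simpl; replace (c * (1 - 1) / (1 - r))%R with 0%R by (field; lra).
      rewrite exp_0; lra.
    - apply Rle_trans with (1 := HS n).
      replace (c * (1 - r ^ S n) / (1 - r))%R
        with (c * r ^ n + c * (1 - r ^ n) / (1 - r))%R by (simpl; field; lra).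
      rewrite exp_plus, <- Rmult_assoc, (Rmult_comm (x 0%nat)), Rmult_assoc.
      assert (0 <= c * r ^ n)%R by (apply Rmult_le_pos; [exact Hc | apply pow_le; lra]).
      apply Rmult_le_compat; [lra | apply Hx | | exact IH].
      apply exp_ineq1_le. }
  apply Rle_trans with (1 := H).
  apply Rmult_le_compat_l; [apply Hx |].
  apply exp_geom_sum_le; assumption.
Qed.

(** The same estimate run downwards from [m]; the constant does not depend on [m], so it is uniform
    in the length of a truncation. *)
Lemma backward_growth (r c : R) (m : nat) (x : nat -> R) :
  (0 <= r < 1)%R -> (0 <= c)%R -> (forall k, (k <= m)%nat -> (0 <= x k)%R) ->
  (forall k, (k < m)%nat -> (x k <= (1 + c * r ^ k) * x (S k))%R) ->
  (x 0%nat <= x m * exp (c / (1 - r)))%R.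
Proof.
  intros Hr Hc Hx HS.
  pose (P := fun n => exp (c * (1 - r ^ n) / (1 - r))).
  assert (H : forall n, (n <= m)%nat -> (x 0%nat <= x n * P n)%R).
  { induction n as [|n IH]; intros Hn; unfold P.
    - simpl; replace (c * (1 - 1) / (1 - r))%R with 0%R by (field; lra).
      rewrite exp_0; lra.
    - apply Rle_trans with (1 := IH ltac:(lia)).
      replace (c * (1 - r ^ S n) / (1 - r))%R
        with (c * r ^ n + c * (1 - r ^ n) / (1 - r))%R by (simpl; field; lra).
      rewrite exp_plus, <- Rmult_assoc.
      apply Rmult_le_compat_r; [left; apply exp_pos |].
      apply Rle_trans with (1 := HS n ltac:(lia)).
      rewrite Rmult_comm; apply Rmult_le_compat_l; [apply Hx; lia | apply exp_ineq1_le]. }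
  apply Rle_trans with (1 := H m (le_n m)).
  apply Rmult_le_compat_l; [apply Hx; lia |]; unfold P.
  apply exp_geom_sum_le; assumption.
Qed.

(** * Convergence of a continued fraction from a bounded solution of its recurrence *)

(** Homogeneous coordinates of the tail: (x, y) stands for x / y, and b + a / (x / y) becomes (b x +
    a y, x), with no case distinction at infinity. *)
Fixpoint cf_pair (a b : nat -> C) (k n : nat) : C * C :=
  match n with
  | O => (b k, RtoC 1)
  | S m => let z := cf_pair a b (S k) m in (b k * fst z + a (S k) * snd z, fst z)
  end.

(** Each step is linear with determinant [- a (S k)], which is nonzero, so the pair never becomes
    (0, 0) and a zero second entry means exactly infinity. *)
Lemma cf_tail_pair (a b : nat -> C) (k n : nat) :
  (forall j, (1 <= j)%nat -> a j <> 0) ->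
  let z := cf_pair a b k n in
  (fst z <> 0 \/ snd z <> 0) /\
  cf_tail a b k n = if Ceq_dec (snd z) 0 then None else Some (fst z / snd z).
Proof.
  intros Ha; revert k; induction n as [|n IH]; intros k; cbn zeta.
  - simpl; split.
    + right; apply C1_nz.
    + destruct (Ceq_dec 1 0) as [H|H]; [now destruct (C1_nz H) |].
      f_equal; field; apply C1_nz.
  - destruct (IH (S k)) as [Hz Ht].
    cbn [cf_pair cf_tail fst snd]; rewrite Ht; clear Ht.
    destruct (cf_pair a b (S k) n) as [x y]; cbn [fst snd] in *.
    assert (Hak : a (S k) <> 0) by (apply Ha; lia).
    destruct (Ceq_dec y 0) as [Hy|Hy]; cbn [Cbar_quot Cbar_shift option_map].
    + assert (Hx : x <> 0) by tauto.
      split; [now right |].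
      destruct (Ceq_dec x 0) as [H|H]; [contradiction |].
      f_equal; rewrite Hy; field; exact Hx.
    + destruct (Ceq_dec x 0) as [Hx|Hx].
      * destruct (Ceq_dec (x / y) 0) as [H|H]; [| destruct H; rewrite Hx; field; exact Hy].
        split; [left | reflexivity].
        rewrite Hx; replace (b k * 0 + a (S k) * y) with (a (S k) * y) by ring.
        now apply Cmult_neq_0.
      * destruct (Ceq_dec (x / y) 0) as [H|H].
        { destruct Hx; replace x with (x / y * y) by (field; exact Hy).
          rewrite H; ring. }
        split; [now right |].
        cbn [Cbar_shift option_map]; f_equal; field; split; assumption.
Qed.

(** If the second entry is 0, the tail is infinite and both sides are 0. *)
Lemma cf_approximant_pair (c : C) (a b : nat -> C) (n : nat) :
  (forall j, (1 <= j)%nat -> a j <> 0) ->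
  fst (cf_pair a b 0 n) <> 0 ->
  cf_approximant c a b n = Some (c * snd (cf_pair a b 0 n) / fst (cf_pair a b 0 n)).
Proof.
  intros Ha Hx; unfold cf_approximant.
  destruct (cf_tail_pair a b 0 n Ha) as [_ ->].
  destruct (cf_pair a b 0 n) as [x y]; cbn [fst snd] in *.
  destruct (Ceq_dec y 0) as [Hy|Hy]; cbn [Cbar_quot].
  - f_equal; rewrite Hy; field; exact Hx.
  - destruct (Ceq_dec (x / y) 0) as [H|H].
    + destruct Hx; replace x with (x / y * y) by (field; exact Hy).
      rewrite H; ring.
    + f_equal; field; split; assumption.
Qed.

(* Both [F] and the backward solution started at [1, 0] satisfy the recurrence, so their
   normalised difference is governed by its last value, [a (n+1) * F (n+2)]. *)
Lemma cf_pair_error (r c A B : R) (a b F : nat -> C) (n : nat) :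
  (0 <= r < 1)%R -> (0 <= c)%R ->
  (forall k, F k = b k * F (S k) + a (S k) * F (S (S k))) ->
  (forall k, (Cmod (b k) + Cmod (a (S k)) <= 1 + c * r ^ k)%R) ->
  (forall k, (Cmod (a (S k)) <= A * r ^ k)%R) ->
  (forall k, (Cmod (F k) <= B)%R) ->
  (Cmod (fst (cf_pair a b 0 n) * F (S n) - F 0%nat) <= A * B * exp (c / (1 - r)) * r ^ n)%R /\
  (Cmod (snd (cf_pair a b 0 n) * F (S n) - F 1%nat) <= A * B * exp (c / (1 - r)) * r ^ n)%R.
Proof.
  intros Hr Hc HF Hab Ha HB.
  (* The truncation ends at [n] for every [k]. Scaling the pair by [F (S n)] makes its second entry
     agree with [F] at [k = n]. *)
  pose (d := fun k => fst (cf_pair a b k (n - k)) * F (S n) - F k).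
  pose (d' := fun k => snd (cf_pair a b k (n - k)) * F (S n) - F (S k)).
  pose (x := fun k => Rmax (Cmod (d k)) (Cmod (d' k))).
  assert (Hx : forall k, (0 <= x k)%R).
  { intros k; apply Rle_trans with (1 := Cmod_ge_0 (d k)), Rmax_l. }
  assert (Hx0 : (x 0%nat <= x n * exp (c / (1 - r)))%R).
  { apply backward_growth; [exact Hr | exact Hc | intros; apply Hx |].
    intros k Hk.
    assert (E' : d' k = d (S k)).
    { unfold d, d'; replace (n - k)%nat with (S (n - S k)) by lia; reflexivity. }
    assert (E : d k = b k * d (S k) + a (S k) * d' (S k)).
    { unfold d, d'; replace (n - k)%nat with (S (n - S k)) by lia.
      cbn [cf_pair fst snd]; rewrite (HF k); ring. }
    assert (Hm : (0 <= c * r ^ k)%R) by (apply Rmult_le_pos; [exact Hc | apply pow_le; lra]).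
    pose proof (Rmax_l (Cmod (d (S k))) (Cmod (d' (S k)))) as H1.
    pose proof (Rmax_r (Cmod (d (S k))) (Cmod (d' (S k)))) as H2.
    fold (x (S k)) in H1, H2.
    specialize (Hx (S k)); specialize (Hab k).
    pose proof (Cmod_ge_0 (b k)); pose proof (Cmod_ge_0 (a (S k))).
    unfold x at 1; apply Rmax_lub.
    - rewrite E; apply Rle_trans with (1 := Cmod_triangle _ _); rewrite !Cmod_mult.
      apply Rle_trans with (Cmod (b k) * x (S k) + Cmod (a (S k)) * x (S k))%R; [| nra].
      apply Rplus_le_compat; apply Rmult_le_compat_l; assumption.
    - rewrite E'; nra. }
  assert (HA : (0 <= A)%R).
  { specialize (Ha 0%nat); simpl in Ha; pose proof (Cmod_ge_0 (a 1%nat)); lra. }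
  assert (Hxn : (x n <= A * B * r ^ n)%R).
  { unfold x, d, d'; rewrite Nat.sub_diag; cbn [cf_pair fst snd].
    replace (b n * F (S n) - F n) with (- (a (S n) * F (S (S n)))) by (rewrite (HF n); ring).
    replace (1 * F (S n) - F (S n)) with (RtoC 0) by ring.
    rewrite Cmod_0, Cmod_opp, Cmod_mult.
    apply Rmax_lub.
    - replace (A * B * r ^ n)%R with (A * r ^ n * B)%R by ring.
      apply Rmult_le_compat; auto using Cmod_ge_0.
    - repeat apply Rmult_le_pos; [exact HA | | apply pow_le; lra].
      apply Rle_trans with (2 := HB 0%nat), Cmod_ge_0. }
  assert (Hxx : (x 0%nat <= A * B * exp (c / (1 - r)) * r ^ n)%R).
  { apply Rle_trans with (1 := Hx0).
    replace (A * B * exp (c / (1 - r)) * r ^ n)%R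
      with (A * B * r ^ n * exp (c / (1 - r)))%R by ring.
    apply Rmult_le_compat_r; [left; apply exp_pos | exact Hxn]. }
  unfold x, d, d' in Hxx; rewrite Nat.sub_0_r in Hxx.
  split; apply Rle_trans with (2 := Hxx); [apply Rmax_l | apply Rmax_r].
Qed.

Lemma cf_approximant_cvg (r c A B : R) (z : C) (a b F : nat -> C) :
  (0 <= r < 1)%R -> (0 <= c)%R ->
  (forall k, (1 <= k)%nat -> a k <> 0) ->
  (forall k, F k = b k * F (S k) + a (S k) * F (S (S k))) ->
  (forall k, (Cmod (b k) + Cmod (a (S k)) <= 1 + c * r ^ k)%R) ->
  (forall k, (Cmod (a (S k)) <= A * r ^ k)%R) ->
  (forall k, (Cmod (F k) <= B)%R) ->
  F 0%nat <> 0 ->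
  filterlim (cf_approximant z a b) eventually (Cbar_locally (Some (z * F 1%nat / F 0%nat))).
Proof.
  intros Hr Hc Hnz HF Hab Ha HB HF0.
  pose (d0 := fun n => fst (cf_pair a b 0 n) * F (S n) - F 0%nat).
  pose (d1 := fun n => snd (cf_pair a b 0 n) * F (S n) - F 1%nat).
  assert (G0 : geo r d0).
  { eexists; intros n; apply (cf_pair_error r c A B a b F n); assumption. }
  assert (G1 : geo r d1).
  { eexists; intros n; apply (cf_pair_error r c A B a b F n); assumption. }
  assert (Gh : geo r (fun n => (z * F 0%nat) * d1 n + (- (z * F 1%nat)) * d0 n)).
  { apply geo_plus;
      [apply geo_mult_bounded with (B := Cmod (z * F 0%nat)) |
       apply geo_mult_bounded with (B := Cmod (- (z * F 1%nat)))];
      first [lra | assumption | intros; apply Rle_refl]. }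
  assert (Hpos : (0 < Cmod (F 0%nat))%R) by now apply Cmod_gt_0.
  (* The scaled first entry tends to [F 0], which is nonzero; hence eventually both its factors are
     nonzero and the approximant is finite. *)
  assert (Hev : eventually (fun n => (Cmod (F 0%nat) / 2 <= Cmod (fst (cf_pair a b 0 n) * F (S n)))%R)).
  { generalize (geo_eventually_small r d0 (Cmod (F 0%nat) / 2) Hr G0 ltac:(lra)).
    apply filter_imp; intros n Hn; unfold d0 in Hn.
    pose proof (Cmod_triangle (fst (cf_pair a b 0 n) * F (S n))
       (- (fst (cf_pair a b 0 n) * F (S n) - F 0%nat))) as H.
    rewrite Cmod_opp in H.
    replace (fst (cf_pair a b 0 n) * F (S n) + - (fst (cf_pair a b 0 n) * F (S n) - F 0%nat))
      with (F 0%nat) in H by ring.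
    lra. }
  assert (Hnz' : forall n, (Cmod (F 0%nat) / 2 <= Cmod (fst (cf_pair a b 0 n) * F (S n)))%R ->
     fst (cf_pair a b 0 n) <> 0 /\ F (S n) <> 0).
  { intros n Hn; split; intros H; rewrite H in Hn;
      [rewrite Cmult_0_l in Hn | rewrite Cmult_0_r in Hn]; rewrite Cmod_0 in Hn; lra. }
  pose (g := fun n => z * snd (cf_pair a b 0 n) / fst (cf_pair a b 0 n)).
  apply (filterlim_ext_loc (fun n => Some (g n))).
  { revert Hev; apply filter_imp; intros n Hn; symmetry.
    apply cf_approximant_pair; [exact Hnz | apply (Hnz' n Hn)]. }
  cut (filterlim g eventually (locally (z * F 1%nat / F 0%nat))).
  { intros Hg; apply (filterlim_comp _ _ _ g (@Some C) eventually (locally (z * F 1%nat / F 0%nat)));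
      [exact Hg |].
    intros P HP; exact HP. }
  apply filterlim_C_ball; intros eps.
  assert (He : (0 < eps * (Cmod (F 0%nat) / 2 * Cmod (F 0%nat)))%R).
  { apply Rmult_lt_0_compat; [apply cond_pos | nra]. }
  generalize (filter_and _ _ Hev (geo_eventually_small r _ _ Hr Gh He)).
  apply filter_imp; intros n [Hn Hh].
  destruct (Hnz' n Hn) as [H1 H2].
  assert (E : g n - z * F 1%nat / F 0%nat =
    (z * F 0%nat * d1 n + - (z * F 1%nat) * d0 n) /
    (fst (cf_pair a b 0 n) * F (S n) * F 0%nat)).
  { unfold g, d0, d1; field; repeat split; assumption. }
  rewrite E, Cmod_div by (repeat apply Cmult_neq_0; assumption).
  rewrite (Cmod_mult (_ * _) (F 0%nat)).
  set (X := Cmod (fst (cf_pair a b 0 n) * F (S n))) in *.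
  apply Rlt_div_l; [nra |].
  apply Rlt_le_trans with (1 := Hh).
  apply Rmult_le_compat_l; [left; apply cond_pos |].
  apply Rmult_le_compat_r; lra.
Qed.

(** * Finite products whose factors approach 1 geometrically *)

Lemma Cinv_mult (z w : C) : z <> 0 -> w <> 0 -> / (z * w) = / z * / w.
Proof. intros Hz Hw; field; split; assumption. Qed.

Fixpoint cprod (f : nat -> C) (n : nat) : C :=
  match n with
  | O => 1
  | S m => cprod f m * f m
  end.

Lemma Cmod_ge_1_minus (z : C) : (1 - Cmod (z - 1) <= Cmod z)%R.
Proof.
  pose proof (Cmod_triangle z (- (z - 1))) as H; rewrite Cmod_opp in H.
  replace (z + - (z - 1)) with (RtoC 1) in H by ring.
  rewrite Cmod_1 in H; lra.
Qed.

Lemma pow_S_bounds (r : R) (n : nat) : (0 <= r < 1)%R -> (0 <= r ^ S n <= r)%R.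
Proof.
  intros Hr; split; [apply pow_le; lra |].
  rewrite <- (pow_1 r) at 2; apply pow_le_pow_base_lt1; [lra | lia].
Qed.

Lemma Cneq_0_of_near_1 (r : R) (z : C) : (r < 1)%R -> (Cmod (z - 1) <= r)%R -> z <> 0.
Proof.
  intros Hr Hz; apply Cmod_gt_0; pose proof (Cmod_ge_1_minus z); lra.
Qed.

Lemma Cmod_inv_near_1 (r : R) (n : nat) (z : C) :
  (0 <= r < 1)%R -> (Cmod (z - 1) <= r ^ S n)%R ->
  (Cmod (/ z) <= 1 + / (1 - r) * r ^ n)%R.
Proof.
  intros Hr Hz.
  pose proof (pow_S_bounds r n Hr) as Hp.
  pose proof (Cmod_ge_1_minus z) as Hz1.
  rewrite Cmod_inv by (apply (Cneq_0_of_near_1 r); lra).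
  apply Rle_trans with (/ (1 - r ^ S n))%R; [apply Rinv_le_contravar; lra |].
  (* This isolates the factor [r ^ n] and gives the form 1 + c r^n asked for by [forward_growth]. *)
  replace (/ (1 - r ^ S n))%R with (1 + r ^ n * (r / (1 - r ^ S n)))%R.
  2:{ rewrite <- tech_pow_Rmult in *; field; lra. }
  rewrite (Rmult_comm (/ (1 - r))).
  apply Rplus_le_compat_l, Rmult_le_compat_l; [apply pow_le; lra |].
  unfold Rdiv; rewrite <- (Rmult_1_l (/ (1 - r))).
  apply Rmult_le_compat; [lra | left; apply Rinv_0_lt_compat; lra | lra |].
  apply Rinv_le_contravar; lra.
Qed.

(** The exponent [S n] keeps even the first factor within [r < 1] of 1, hence nonzero. *)
Definition near_1 (r : R) (f : nat -> C) : Prop :=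
  forall n, (Cmod (f n - 1) <= r ^ S n)%R.

Lemma near_1_term_neq_0 (r : R) (f : nat -> C) (n : nat) :
  (0 <= r < 1)%R -> near_1 r f -> f n <> 0.
Proof.
  intros Hr Hf; apply (Cneq_0_of_near_1 r); [lra |].
  apply Rle_trans with (1 := Hf n), pow_S_bounds, Hr.
Qed.

Lemma cprod_neq_0 (r : R) (f : nat -> C) (n : nat) :
  (0 <= r < 1)%R -> near_1 r f -> cprod f n <> 0.
Proof.
  intros Hr Hf; induction n as [|n IH]; simpl; [apply C1_nz |].
  apply Cmult_neq_0; [exact IH | now apply (near_1_term_neq_0 r)].
Qed.

(** The constant of [forward_growth] with c = 1 / (1 - r), large enough for the products and for
    their inverses. *)
Definition cprod_bound (r : R) : R := exp (/ (1 - r) / (1 - r)).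

Lemma cprod_bounded (r : R) (f : nat -> C) (n : nat) :
  (0 <= r < 1)%R -> near_1 r f ->
  (Cmod (cprod f n) <= cprod_bound r)%R /\ (Cmod (/ cprod f n) <= cprod_bound r)%R.
Proof.
  intros Hr Hf.
  assert (Hi : (1 <= / (1 - r))%R).
  { rewrite <- Rinv_1 at 1; apply Rinv_le_contravar; lra. }
  pose proof (fun k => cprod_neq_0 r f k Hr Hf) as Hnz.
  split.
  - assert (H := forward_growth r (/ (1 - r)) (fun n => Cmod (cprod f n)) Hr ltac:(lra)
      (fun n => Cmod_ge_0 _)).
    simpl in H; rewrite Cmod_1, Rmult_1_l in H; apply H; clear H.
    intros k; rewrite Cmod_mult, Rmult_comm.
    apply Rmult_le_compat_r; [apply Cmod_ge_0 |].
    pose proof (Cmod_triangle 1 (f k - 1)) as H; replace (1 + (f k - 1)) with (f k) in H by ring.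
    rewrite Cmod_1 in H; pose proof (Hf k) as H'; rewrite <- tech_pow_Rmult in H'.
    assert (0 <= r ^ k)%R by (apply pow_le; lra); nra.
  - assert (H := forward_growth r (/ (1 - r)) (fun n => Cmod (/ cprod f n)) Hr ltac:(lra)
      (fun n => Cmod_ge_0 _)).
    simpl in H; rewrite Cmod_inv, Cmod_1, Rinv_1, Rmult_1_l in H by apply C1_nz.
    apply H; clear H.
    intros k; rewrite Cinv_mult, Cmod_mult, Rmult_comm
      by first [apply Hnz | now apply (near_1_term_neq_0 r)].
    apply Rmult_le_compat_r; [apply Cmod_ge_0 |].
    apply Cmod_inv_near_1; [exact Hr | apply Hf].
Qed.

(** Each numerator contributes a factor [r]; the denominators together form an inverse product that
    stays bounded. *)
Lemma cprod_geo_bounded (r : R) (f g : nat -> C) (n : nat) :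
  (0 <= r < 1)%R -> near_1 r g ->
  (forall k, (Cmod (f k) <= r)%R) ->
  (Cmod (cprod (fun k => (f k / g k)%C) n) <= cprod_bound r * r ^ n)%R.
Proof.
  intros Hr Hg Hf.
  assert (H : forall n, (Cmod (cprod (fun k => (f k / g k)%C) n)
    <= Cmod (/ cprod g n) * r ^ n)%R).
  { clear n; induction n as [|n IH].
    - simpl; replace (/ 1) with (RtoC 1) by (field; apply C1_nz); lra.
    - cbn [cprod pow].
      assert (Hg0 : g n <> 0) by now apply (near_1_term_neq_0 r).
      assert (Hp : cprod g n <> 0) by now apply (cprod_neq_0 r).
      rewrite Cmod_mult, Cinv_mult by assumption.
      unfold Cdiv; rewrite !Cmod_mult.
      replace (Cmod (/ cprod g n) * Cmod (/ g n) * (r * r ^ n))%R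
        with ((Cmod (/ cprod g n) * r ^ n) * (r * Cmod (/ g n)))%R by ring.
      apply Rmult_le_compat; [apply Cmod_ge_0 | | exact IH |].
      + apply Rmult_le_pos; apply Cmod_ge_0.
      + apply Rmult_le_compat_r; [apply Cmod_ge_0 | apply Hf]. }
  apply Rle_trans with (1 := H n), Rmult_le_compat_r; [apply pow_le; lra |].
  now apply cprod_bounded.
Qed.

(** * The summands as q-hypergeometric terms, and their bounds *)

Lemma Cpow_double (z : C) (n : nat) : z ^ (2 * n) = z ^ n * z ^ n.
Proof. rewrite <- Cpow_add_r; f_equal; lia. Qed.

Lemma Cpow_quadruple (z : C) (n : nat) : z ^ (4 * n) = z ^ n * z ^ n * z ^ n * z ^ n.
Proof. rewrite <- !Cpow_add_r; f_equal; lia. Qed.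

Lemma one_plus_pow_neq_0 (q : C) (n : nat) : (Cmod q < 1)%R -> 1 + q ^ n <> 0.
Proof.
  intros Hq H.
  destruct n as [|n].
  - simpl in H; apply (f_equal Re) in H; simpl in H; lra.
  - revert H; apply (Cneq_0_of_near_1 (Cmod q)); [exact Hq |].
    replace (1 + q ^ S n - 1) with (q ^ S n) by ring.
    rewrite Cmod_pow; apply pow_S_bounds; split; [apply Cmod_ge_0 | exact Hq].
Qed.

Lemma one_minus_pow_neq_0 (q : C) (n : nat) : (Cmod q < 1)%R -> (1 <= n)%nat -> 1 - q ^ n <> 0.
Proof.
  intros Hq Hn; destruct n as [|n]; [lia |].
  apply (Cneq_0_of_near_1 (Cmod q)); [exact Hq |].
  replace (1 - q ^ S n - 1) with (- q ^ S n) by ring.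
  rewrite Cmod_opp, Cmod_pow; apply pow_S_bounds; split; [apply Cmod_ge_0 | exact Hq].
Qed.

Lemma Cmod_inv_one_plus_pow (q : C) (n : nat) :
  (Cmod q < 1)%R -> (Cmod (/ (1 + q ^ n)) <= / (1 - Cmod q))%R.
Proof.
  intros Hq; pose proof (Cmod_ge_0 q) as Hr.
  rewrite Cmod_inv by now apply one_plus_pow_neq_0.
  apply Rinv_le_contravar; [lra |].
  destruct n as [|n].
  - replace (1 + q ^ 0) with (RtoC 2) by (simpl; apply injective_projections; simpl; ring).
    rewrite Cmod_R, Rabs_pos_eq; lra.
  - pose proof (Cmod_ge_1_minus (1 + q ^ S n)) as H.
    replace (1 + q ^ S n - 1) with (q ^ S n) in H by ring.
    rewrite Cmod_pow in H; pose proof (pow_S_bounds (Cmod q) n ltac:(lra)); lra.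
Qed.

(** [pochm] and [pochp] are (q^2;q^2)_n and (-q^2;q^2)_n. *)
Definition pochm (q : C) : nat -> C := cprod (fun i => 1 - q ^ (2 * i + 2)).
Definition pochp (q : C) : nat -> C := cprod (fun i => 1 + q ^ (2 * i + 2)).

Lemma near_1_pow (q : C) (e : nat -> nat) :
  (Cmod q < 1)%R -> (forall i, (i < e i)%nat) -> near_1 (Cmod q) (fun i => 1 + q ^ e i).
Proof.
  intros Hq He i.
  replace (1 + q ^ e i - 1) with (q ^ e i) by ring.
  rewrite Cmod_pow; apply pow_le_pow_base_lt1; [pose proof (Cmod_ge_0 q); lra | apply He].
Qed.

Lemma near_1_minus_pow (q : C) (e : nat -> nat) :
  (Cmod q < 1)%R -> (forall i, (i < e i)%nat) -> near_1 (Cmod q) (fun i => 1 - q ^ e i).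
Proof.
  intros Hq He i.
  replace (1 - q ^ e i - 1) with (- q ^ e i) by ring.
  rewrite Cmod_opp, Cmod_pow.
  apply pow_le_pow_base_lt1; [pose proof (Cmod_ge_0 q); lra | apply He].
Qed.

Lemma pochm_neq_0 (q : C) (n : nat) : (Cmod q < 1)%R -> pochm q n <> 0.
Proof.
  intros Hq; apply (cprod_neq_0 (Cmod q)); [split; [apply Cmod_ge_0 | exact Hq] |].
  apply near_1_minus_pow; [exact Hq | lia].
Qed.

Lemma pochp_neq_0 (q : C) (n : nat) : (Cmod q < 1)%R -> pochp q n <> 0.
Proof.
  intros Hq; apply (cprod_neq_0 (Cmod q)); [split; [apply Cmod_ge_0 | exact Hq] |].
  apply near_1_pow; [exact Hq | lia].
Qed.

(* The sums of [eterm q m], [tterm q n m], [fterm q n] and [gterm q n] are E_m, T_(n,m),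
   F_(2n) (for n >= 1) and F_(2n+1). *)
Definition eterm (q : C) (m k : nat) : C := q ^ (k * k + 2 * (m * k)) / pochm q k.

Definition tterm (q : C) (n m k : nat) : C :=
  / (1 + q ^ (2 * n + 2 * k)) * (q ^ (2 * k) * eterm q m k).

Definition fterm (q : C) (n k : nat) : C :=
  q ^ (k * k + 4 * (n * k)) * pochp q k / ((1 + q ^ (2 * k)) * pochm q k * pochp q (n + k)).

Definition gterm (q : C) (n k : nat) : C := q ^ (2 * k) * fterm q n k.

Lemma eterm_Cmod_le (q : C) (m k : nat) :
  (Cmod q < 1)%R ->
  (Cmod (eterm q m k) <= cprod_bound (Cmod q) * Cmod q ^ (k * k + 2 * (m * k)))%R.
Proof.
  intros Hq; unfold eterm, Cdiv; pose proof (Cmod_ge_0 q).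
  rewrite Cmod_mult, Cmod_pow, Rmult_comm.
  apply Rmult_le_compat_r; [apply pow_le; lra |].
  apply cprod_bounded; [lra | apply near_1_minus_pow; [exact Hq | lia]].
Qed.

Lemma eterm_geo (q : C) (m : nat) : (Cmod q < 1)%R -> geo (Cmod q) (eterm q m).
Proof.
  intros Hq; exists (cprod_bound (Cmod q)); intros k.
  apply Rle_trans with (1 := eterm_Cmod_le q m k Hq).
  apply Rmult_le_compat_l; [left; apply exp_pos |].
  apply pow_le_pow_base_lt1; [pose proof (Cmod_ge_0 q); lra | nia].
Qed.

Lemma Cmod_pow_le_1 (q : C) (n : nat) : (Cmod q < 1)%R -> (Cmod (q ^ n) <= 1)%R.
Proof.
  intros Hq; rewrite Cmod_pow, <- (pow_O (Cmod q)).
  apply pow_le_pow_base_lt1; [pose proof (Cmod_ge_0 q); lra | lia].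
Qed.

Lemma tterm_Cmod_le (q : C) (n m k : nat) :
  (Cmod q < 1)%R ->
  (Cmod (tterm q n m k) <= / (1 - Cmod q) * cprod_bound (Cmod q) * Cmod q ^ k)%R.
Proof.
  intros Hq; pose proof (Cmod_ge_0 q); unfold tterm.
  rewrite 2!Cmod_mult, Rmult_assoc.
  apply Rmult_le_compat; [apply Cmod_ge_0 | apply Rmult_le_pos; apply Cmod_ge_0 | |].
  - rewrite <- Nat.mul_add_distr_l; now apply Cmod_inv_one_plus_pow.
  - rewrite <- (Rmult_1_l (_ * _ ^ k)).
    apply Rmult_le_compat; try apply Cmod_ge_0; [now apply Cmod_pow_le_1 |].
    apply Rle_trans with (1 := eterm_Cmod_le q m k Hq).
    apply Rmult_le_compat_l; [left; apply exp_pos |].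
    apply pow_le_pow_base_lt1; [lra | nia].
Qed.

Lemma tterm_geo (q : C) (n m : nat) : (Cmod q < 1)%R -> geo (Cmod q) (tterm q n m).
Proof. intros Hq; eexists; intros k; now apply tterm_Cmod_le. Qed.

(** One factor for 1 / (1 + q^(2k)), and one [cprod_bound] for each of the three products in
    [fterm]. *)
Definition fterm_bound (r : R) : R := (/ (1 - r) * cprod_bound r ^ 3)%R.

Lemma fterm_Cmod_le (q : C) (n k : nat) :
  (Cmod q < 1)%R -> (Cmod (fterm q n k) <= fterm_bound (Cmod q) * Cmod q ^ k)%R.
Proof.
  intros Hq; pose proof (Cmod_ge_0 q).
  replace (fterm q n k) with
    (q ^ (k * k + 4 * (n * k)) *
     (/ (1 + q ^ (2 * k)) * (pochp q k * (/ pochm q k * / pochp q (n + k))))).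
  2:{ unfold fterm; field; repeat split;
      first [now apply pochp_neq_0 | now apply pochm_neq_0 | now apply one_plus_pow_neq_0]. }
  assert (Hp : forall j, (Cmod (pochp q j) <= cprod_bound (Cmod q))%R /\
                         (Cmod (/ pochp q j) <= cprod_bound (Cmod q))%R).
  { intros j; apply cprod_bounded; [lra | apply near_1_pow; [exact Hq | lia]]. }
  assert (Hm : forall j, (Cmod (/ pochm q j) <= cprod_bound (Cmod q))%R).
  { intros j; apply cprod_bounded; [lra | apply near_1_minus_pow; [exact Hq | lia]]. }
  rewrite !Cmod_mult, Rmult_comm, Cmod_pow; unfold fterm_bound.
  apply Rmult_le_compat; [| apply pow_le; lra | |].
  - repeat apply Rmult_le_pos; apply Cmod_ge_0.
  - cbn [pow]; rewrite Rmult_1_r.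
    repeat (apply Rmult_le_compat;
      [apply Cmod_ge_0 | repeat apply Rmult_le_pos; apply Cmod_ge_0 | |]).
    + now apply Cmod_inv_one_plus_pow.
    + apply Hp.
    + apply Hm.
    + apply Hp.
  - apply pow_le_pow_base_lt1; [lra | nia].
Qed.

Lemma fterm_geo (q : C) (n : nat) : (Cmod q < 1)%R -> geo (Cmod q) (fterm q n).
Proof. intros Hq; eexists; intros k; now apply fterm_Cmod_le. Qed.

Lemma gterm_Cmod_le (q : C) (n k : nat) :
  (Cmod q < 1)%R -> (Cmod (gterm q n k) <= fterm_bound (Cmod q) * Cmod q ^ k)%R.
Proof.
  intros Hq; unfold gterm; rewrite Cmod_mult.
  rewrite <- (Rmult_1_l (_ * _ ^ k)).
  apply Rmult_le_compat; try apply Cmod_ge_0; [now apply Cmod_pow_le_1 | now apply fterm_Cmod_le].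
Qed.

Lemma gterm_geo (q : C) (n : nat) : (Cmod q < 1)%R -> geo (Cmod q) (gterm q n).
Proof. intros Hq; eexists; intros k; now apply gterm_Cmod_le. Qed.

(** * Ratios of summands and the recurrence of the continued fraction *)

(** Here and in the next three lemmas a shifted summand is the original one times a rational
    function of powers of [q]; termwise identities then become rational ones. *)
Lemma eterm_S_index (q : C) (m k : nat) :
  (Cmod q < 1)%R ->
  eterm q m (S k) = eterm q m k * (q ^ (2 * k + 1 + 2 * m) / (1 - q ^ (2 * k + 2))).
Proof.
  intros Hq; unfold eterm; cbn [pochm cprod].
  replace (S k * S k + 2 * (m * S k))%nat
    with ((k * k + 2 * (m * k)) + (2 * k + 1 + 2 * m))%nat by ring.
  rewrite (Cpow_add_r q (k * k + 2 * (m * k))).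
  change (pochm q (S k)) with (pochm q k * (1 - q ^ (2 * k + 2))).
  field; split; [apply one_minus_pow_neq_0; [exact Hq | lia] | now apply pochm_neq_0].
Qed.

Lemma eterm_S_param (q : C) (m k : nat) : eterm q (S m) k = eterm q m k * q ^ (2 * k).
Proof.
  unfold eterm.
  replace (k * k + 2 * (S m * k))%nat with ((k * k + 2 * (m * k)) + 2 * k)%nat by ring.
  rewrite Cpow_add_r; unfold Cdiv; ring.
Qed.

Lemma fterm_S_index (q : C) (n k : nat) :
  (Cmod q < 1)%R ->
  fterm q n (S k) = fterm q n k *
    (q ^ (2 * k + 1 + 4 * n) * (1 + q ^ (2 * k)) /
     ((1 - q ^ (2 * k + 2)) * (1 + q ^ (2 * (n + k) + 2)))).
Proof.
  intros Hq; unfold fterm.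
  replace (S k * S k + 4 * (n * S k))%nat
    with ((k * k + 4 * (n * k)) + (2 * k + 1 + 4 * n))%nat by ring.
  rewrite (Cpow_add_r q (k * k + 4 * (n * k))).
  rewrite (Nat.add_succ_r n k).
  change (pochm q (S k)) with (pochm q k * (1 - q ^ (2 * k + 2))).
  change (pochp q (S k)) with (pochp q k * (1 + q ^ (2 * k + 2))).
  change (pochp q (S (n + k))) with (pochp q (n + k) * (1 + q ^ (2 * (n + k) + 2))).
  replace (2 * S k)%nat with (2 * k + 2)%nat by ring.
  field; repeat split;
    first [now apply pochp_neq_0 | now apply pochm_neq_0 | now apply one_plus_pow_neq_0
          | apply one_minus_pow_neq_0; [exact Hq | lia]].
Qed.

Lemma fterm_S_param (q : C) (n k : nat) :
  (Cmod q < 1)%R ->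
  fterm q (S n) k = fterm q n k * (q ^ (4 * k) / (1 + q ^ (2 * (n + k) + 2))).
Proof.
  intros Hq; unfold fterm.
  replace (k * k + 4 * (S n * k))%nat with ((k * k + 4 * (n * k)) + 4 * k)%nat by ring.
  rewrite (Cpow_add_r q (k * k + 4 * (n * k))).
  change (pochp q (S n + k)) with (pochp q (n + k) * (1 + q ^ (2 * (n + k) + 2))).
  field; repeat split;
    first [now apply pochp_neq_0 | now apply pochm_neq_0 | now apply one_plus_pow_neq_0].
Qed.

(** Decay of the certificate used in most recurrences below; its factor 1 - q^(2k) removes the
    boundary term at k = 0. *)
Lemma geo_opp_one_minus (q : C) (u : nat -> C) :
  (Cmod q < 1)%R -> geo (Cmod q) u -> geo (Cmod q) (fun k => - (1 - q ^ (2 * k)) * u k).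
Proof.
  intros Hq Hu; apply geo_mult_bounded with (B := 2%R); [apply Cmod_ge_0 | | exact Hu].
  intros k; rewrite Cmod_opp.
  apply Rle_trans with (1 := Cmod_triangle _ _).
  rewrite Cmod_1, Cmod_opp; pose proof (Cmod_pow_le_1 q (2 * k) Hq); lra.
Qed.

(** Reduces all exponents to single variables, so that [field] can treat q^n, q^k and the like as
    independent unknowns. *)
Ltac expand_powers :=
  rewrite ?Nat.mul_add_distr_l, ?Cpow_add_r, ?Cpow_double, ?Cpow_quadruple, ?Cpow_1_r.

Ltac expand_powers_in H :=
  rewrite ?Nat.mul_add_distr_l, ?Cpow_add_r, ?Cpow_double, ?Cpow_quadruple, ?Cpow_1_r in H.

(** The relation at index 2n, for n >= 1. At n = 0 the left side is not F_0, and [fsum_gsum_0]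
    supplies the difference. *)
Lemma fsum_rec (q : C) (n : nat) :
  (Cmod q < 1)%R ->
  CSum (fterm q n) = (1 + q ^ (4 * n + 1)) * CSum (gterm q n) +
    q ^ (4 * n + 1) * (1 - q ^ (2 * n + 2)) * CSum (fterm q (S n)).
Proof.
  intros Hq.
  rewrite (CSum_telescope (Cmod q) (fterm q n) (gterm q n) (fterm q (S n))
    (fun k => - (1 - q ^ (2 * k)) * fterm q n k)
    (1 + q ^ (4 * n + 1)) (q ^ (4 * n + 1) * (1 - q ^ (2 * n + 2)))).
  - simpl; ring.
  - split; [apply Cmod_ge_0 | exact Hq].
  - now apply fterm_geo.
  - now apply gterm_geo.
  - now apply fterm_geo.
  - apply geo_opp_one_minus; [exact Hq | now apply fterm_geo].
  - intros k; unfold gterm; rewrite fterm_S_index, fterm_S_param by exact Hq.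
    replace (2 * S k)%nat with (2 * k + 2)%nat by ring.
    pose proof (one_minus_pow_neq_0 q (2 * k + 2) Hq ltac:(lia)) as H1.
    pose proof (one_plus_pow_neq_0 q (2 * (n + k) + 2) Hq) as H2.
    expand_powers_in H1; expand_powers_in H2; expand_powers.
    field; split; assumption.
Qed.

Lemma gsum_rec (q : C) (n : nat) :
  (Cmod q < 1)%R ->
  CSum (gterm q n) = (1 + q ^ (4 * n + 3)) * CSum (fterm q (S n)) +
    (q ^ (2 * n + 2) + q ^ (4 * n + 3)) * CSum (gterm q (S n)).
Proof.
  intros Hq.
  rewrite (CSum_telescope (Cmod q) (gterm q n) (fterm q (S n)) (gterm q (S n))
    (fun k => - (1 - q ^ (2 * k)) * gterm q n k)
    (1 + q ^ (4 * n + 3)) (q ^ (2 * n + 2) + q ^ (4 * n + 3))).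
  - simpl; ring.
  - split; [apply Cmod_ge_0 | exact Hq].
  - now apply gterm_geo.
  - now apply fterm_geo.
  - now apply gterm_geo.
  - apply geo_opp_one_minus; [exact Hq | now apply gterm_geo].
  - intros k; unfold gterm; rewrite fterm_S_index, fterm_S_param by exact Hq.
    replace (2 * S k)%nat with (2 * k + 2)%nat by ring.
    pose proof (one_minus_pow_neq_0 q (2 * k + 2) Hq ltac:(lia)) as H1.
    pose proof (one_plus_pow_neq_0 q (2 * (n + k) + 2) Hq) as H2.
    expand_powers_in H1; expand_powers_in H2; expand_powers.
    field; split; assumption.
Qed.

Lemma RtoC_2 : RtoC 2 = 1 + 1.
Proof. exact (RtoC_plus 1 1). Qed.

Lemma CSum_ext (a b : nat -> C) : (forall n, a n = b n) -> CSum a = CSum b.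
Proof.
  intros H; unfold CSum; f_equal; apply Series_ext; intros n; now rewrite H.
Qed.

(** * The sums E_m and the nonvanishing of E_0 *)

(** One step of Euler's product for E_0, whose factors are 1 + q^(2i+1). The second slot of
    [CSum_telescope] is filled with coefficient 0. *)
Lemma esum_rec (q : C) (m : nat) :
  (Cmod q < 1)%R -> CSum (eterm q m) = (1 + q ^ (2 * m + 1)) * CSum (eterm q (S m)).
Proof.
  intros Hq.
  rewrite (CSum_telescope (Cmod q) (eterm q m) (eterm q (S m)) (eterm q (S m))
    (fun k => - (1 - q ^ (2 * k)) * eterm q m k) (1 + q ^ (2 * m + 1)) 0).
  - simpl; ring.
  - split; [apply Cmod_ge_0 | exact Hq].
  - now apply eterm_geo.
  - now apply eterm_geo.
  - now apply eterm_geo.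
  - apply geo_opp_one_minus; [exact Hq | now apply eterm_geo].
  - intros k; rewrite eterm_S_index, eterm_S_param by exact Hq.
    replace (2 * S k)%nat with (2 * k + 2)%nat by ring.
    pose proof (one_minus_pow_neq_0 q (2 * k + 2) Hq ltac:(lia)) as H1.
    expand_powers_in H1; expand_powers.
    field; exact H1.
Qed.

(** The term at k = 0 is 1, and for the term k + 1 the exponent (k+1)^2 + 2m(k+1) is at least m +
    k. *)
Lemma esum_near_1 (q : C) (m : nat) :
  (Cmod q < 1)%R ->
  (Cmod (CSum (eterm q m) - 1) <= cprod_bound (Cmod q) / (1 - Cmod q) * Cmod q ^ m)%R.
Proof.
  intros Hq; pose proof (Cmod_ge_0 q).
  replace (cprod_bound (Cmod q) / (1 - Cmod q) * Cmod q ^ m)%R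
    with ((cprod_bound (Cmod q) * Cmod q ^ m) / (1 - Cmod q))%R by (field; lra).
  apply (is_series_Cmod_le (Cmod q) _ (fun k => eterm q m (S k))); [lra | |].
  - intros k; apply Rle_trans with (1 := eterm_Cmod_le q m (S k) Hq).
    rewrite Rmult_assoc, <- pow_add.
    apply Rmult_le_compat_l; [left; apply exp_pos |].
    apply pow_le_pow_base_lt1; [lra | nia].
  - apply is_series_incr_1.
    change (is_series (eterm q m) (CSum (eterm q m) - 1 + eterm q m 0%nat)).
    replace (CSum (eterm q m) - 1 + eterm q m 0%nat) with (CSum (eterm q m)).
    2:{ replace (eterm q m 0) with (RtoC 1); [ring |].
        unfold eterm; rewrite (Nat.mul_0_r m); change (pochm q 0) with (RtoC 1).
        simpl; field; apply C1_nz. }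
    apply (CSum_correct (Cmod q)); [lra | now apply eterm_geo].
Qed.

(** If E_0 were 0, the nonzero factors in [esum_rec] would force every E_m to be 0, while E_m tends
    to 1. *)
Lemma esum_neq_0 (q : C) : (Cmod q < 1)%R -> CSum (eterm q 0) <> 0.
Proof.
  intros Hq H0.
  assert (H : forall m, CSum (eterm q m) = 0).
  { induction m as [|m IH]; [exact H0 |].
    rewrite esum_rec in IH by exact Hq.
    destruct (Ceq_dec (CSum (eterm q (S m))) 0) as [E|E]; [exact E |].
    destruct (Cmult_neq_0 _ _ (one_plus_pow_neq_0 q (2 * m + 1) Hq) E IH). }
  destruct (geo_eventually_small (Cmod q) (fun m => CSum (eterm q m) - 1) 1) as [N HN].
  - split; [apply Cmod_ge_0 | exact Hq].
  - eexists; intros m; now apply esum_near_1.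
  - lra.
  - specialize (HN N (le_n N)); rewrite H in HN.
    replace (0 - 1) with (- (1)) in HN by ring; rewrite Cmod_m1 in HN; lra.
Qed.

(** * The sums T_(n,m) and their diagonal recurrence *)

Lemma tsum_rec_base (q : C) (n m : nat) :
  (Cmod q < 1)%R ->
  CSum (eterm q m) = (1 + q ^ (2 * n)) * CSum (tterm q n m) +
    q ^ (2 * m + 1) * CSum (tterm q (S n) m).
Proof.
  intros Hq.
  rewrite (CSum_telescope (Cmod q) (eterm q m) (tterm q n m) (tterm q (S n) m)
    (fun k => / (1 + q ^ (2 * n + 2 * k)) * (- (1 - q ^ (2 * k)) * eterm q m k))
    (1 + q ^ (2 * n)) (q ^ (2 * m + 1))).
  - simpl; ring.
  - split; [apply Cmod_ge_0 | exact Hq].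
  - now apply eterm_geo.
  - now apply tterm_geo.
  - now apply tterm_geo.
  - apply geo_mult_bounded with (B := (/ (1 - Cmod q))%R); [apply Cmod_ge_0 | |].
    + intros k; now apply Cmod_inv_one_plus_pow.
    + apply geo_opp_one_minus; [exact Hq | now apply eterm_geo].
  - intros k; unfold tterm; rewrite eterm_S_index by exact Hq.
    replace (2 * S n + 2 * k)%nat with (2 * n + 2 * k + 2)%nat by ring.
    replace (2 * n + 2 * S k)%nat with (2 * n + 2 * k + 2)%nat by ring.
    replace (2 * S k)%nat with (2 * k + 2)%nat by ring.
    pose proof (one_minus_pow_neq_0 q (2 * k + 2) Hq ltac:(lia)) as H1.
    pose proof (one_plus_pow_neq_0 q (2 * n + 2 * k) Hq) as H2.
    pose proof (one_plus_pow_neq_0 q (2 * n + 2 * k + 2) Hq) as H3.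
    expand_powers_in H1; expand_powers_in H2; expand_powers_in H3; expand_powers.
    field; repeat split; assumption.
Qed.

(** Termwise this is 1 / (1 + x) = 1 - x / (1 + x) with x = q^(2n+2k), so the certificate is 0. *)
Lemma tsum_rec_arg (q : C) (n m : nat) :
  (Cmod q < 1)%R ->
  CSum (tterm q n m) = CSum (eterm q (S m)) - q ^ (2 * n) * CSum (tterm q n (S m)).
Proof.
  intros Hq.
  rewrite (CSum_telescope (Cmod q) (tterm q n m) (eterm q (S m)) (tterm q n (S m))
    (fun _ => 0) 1 (- q ^ (2 * n))).
  - ring.
  - split; [apply Cmod_ge_0 | exact Hq].
  - now apply tterm_geo.
  - now apply eterm_geo.
  - now apply tterm_geo.
  - exists 0%R; intros; rewrite Cmod_0; lra.
  - intros k; unfold tterm; rewrite eterm_S_param.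
    pose proof (one_plus_pow_neq_0 q (2 * n + 2 * k) Hq) as H2.
    expand_powers_in H2; expand_powers.
    field; exact H2.
Qed.

(** Substituting the recurrence for E_n and the expansion of T_(n+1,n) into [tsum_rec_base] at m =
    n, the terms q^(2n+1) E_(n+1) cancel. *)
Lemma tsum_rec_diag (q : C) (n : nat) :
  (Cmod q < 1)%R ->
  (1 + q ^ (2 * n)) * CSum (tterm q n n) =
    CSum (eterm q (S n)) + q ^ (4 * n + 3) * CSum (tterm q (S n) (S n)).
Proof.
  intros Hq.
  pose proof (tsum_rec_base q n n Hq) as H1.
  rewrite (esum_rec q n Hq), (tsum_rec_arg q (S n) n Hq) in H1.
  replace (2 * S n)%nat with (2 * n + 2)%nat in H1 by ring.
  expand_powers_in H1; expand_powers.
  match type of H1 with _ = ?A * ?T + ?B => replace (A * T) with ((A * T + B) - B) by ring end.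
  rewrite <- H1; ring.
Qed.

(** * The series H_n and the false theta series *)

(* The j-th term (-1)^j q^(j(j+1)/2 + 2nj) / (-q^(n+1);q)_j of H_n. *)
Definition hterm (q : C) (n : nat) : nat -> C :=
  cprod (fun i => - q ^ (S i + 2 * n) / (1 + q ^ (n + i + 1))).

Lemma hterm_Cmod_le (q : C) (n j : nat) :
  (Cmod q < 1)%R -> (Cmod (hterm q n j) <= cprod_bound (Cmod q) * Cmod q ^ j)%R.
Proof.
  intros Hq; pose proof (Cmod_ge_0 q); unfold hterm.
  apply (cprod_geo_bounded (Cmod q) (fun i => - q ^ (S i + 2 * n)) (fun i => 1 + q ^ (n + i + 1)));
    [lra | apply near_1_pow; [exact Hq | lia] |].
  intros k; rewrite Cmod_opp, Cmod_pow; apply (pow_S_bounds (Cmod q) (k + 2 * n)); lra.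
Qed.

Lemma hterm_geo (q : C) (n : nat) : (Cmod q < 1)%R -> geo (Cmod q) (hterm q n).
Proof. intros Hq; eexists; intros j; now apply hterm_Cmod_le. Qed.

Lemma hterm_S_param (q : C) (n j : nat) :
  (Cmod q < 1)%R ->
  hterm q (S n) j = hterm q n j * (q ^ (2 * j) * (1 + q ^ (n + 1)) / (1 + q ^ (n + j + 1))).
Proof.
  intros Hq; induction j as [|j IH].
  - change (RtoC 1 = 1 * (1 * (1 + q ^ (n + 1)) / (1 + q ^ (n + 0 + 1)))).
    rewrite Nat.add_0_r; field; now apply one_plus_pow_neq_0.
  - unfold hterm; cbn [cprod]; fold (hterm q n j) (hterm q (S n) j).
    rewrite IH.
    replace (S n + j + 1)%nat with (n + j + 2)%nat by ring.
    replace (n + S j + 1)%nat with (n + j + 2)%nat by ring.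
    replace (2 * S j)%nat with (2 * j + 2)%nat by ring.
    replace (S j + 2 * S n)%nat with (j + 2 * n + 3)%nat by ring.
    replace (S j + 2 * n)%nat with (j + 2 * n + 1)%nat by ring.
    pose proof (one_plus_pow_neq_0 q (n + j + 2) Hq) as H1.
    pose proof (one_plus_pow_neq_0 q (n + j + 1) Hq) as H2.
    expand_powers_in H1; expand_powers_in H2; expand_powers.
    field; split; assumption.
Qed.

(** The certificate (q^(2n+1+j) - 1) times the j-th term does not vanish at j = 0; its boundary
    value yields the explicit part 1 - q^(2n+1). *)
Lemma hsum_rec (q : C) (n : nat) :
  (Cmod q < 1)%R ->
  CSum (hterm q n) = 1 - q ^ (2 * n + 1) + q ^ (3 * n + 2) * CSum (hterm q (S n)).
Proof.
  intros Hq.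
  rewrite (CSum_telescope (Cmod q) (hterm q n) (hterm q (S n)) (hterm q n)
    (fun j => (q ^ (2 * n + 1 + j) - 1) * hterm q n j)
    (q ^ (3 * n + 2)) 0).
  - change (hterm q n 0) with (RtoC 1); rewrite Nat.add_0_r; ring.
  - split; [apply Cmod_ge_0 | exact Hq].
  - now apply hterm_geo.
  - now apply hterm_geo.
  - now apply hterm_geo.
  - apply geo_mult_bounded with (B := 2%R); [apply Cmod_ge_0 | | now apply hterm_geo].
    intros k; apply Rle_trans with (1 := Cmod_triangle _ _).
    rewrite Cmod_m1; pose proof (Cmod_pow_le_1 q (2 * n + 1 + k) Hq); lra.
  - intros j; rewrite hterm_S_param by exact Hq.
    change (hterm q n (S j)) with
      (hterm q n j * (- q ^ (S j + 2 * n) / (1 + q ^ (n + j + 1)))).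
    replace (S j + 2 * n)%nat with (j + 2 * n + 1)%nat by ring.
    replace (2 * n + 1 + S j)%nat with (j + 2 * n + 2)%nat by ring.
    replace (3 * n)%nat with (n + n + n)%nat by ring.
    pose proof (one_plus_pow_neq_0 q (n + j + 1) Hq) as H2.
    expand_powers_in H2; expand_powers.
    field; exact H2.
Qed.

(** Iterating the diagonal recurrence gives 2 T_(0,0) as the sum of g_n E_(n+1). By the recurrence
    for E_m, this summand is E_0 times the terms 2n and 2n+1 of H_0 taken together. *)
Lemma two_tsum_eq_esum_hsum (q : C) :
  (Cmod q < 1)%R ->
  2 * CSum (tterm q 0 0) = CSum (eterm q 0) * CSum (hterm q 0).
Proof.
  intros Hq; pose proof (Cmod_ge_0 q) as Hr.
  pose (g := cprod (fun i => q ^ (4 * i + 3) / (1 + q ^ (2 * i + 2)))).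
  assert (Hge : forall n, hterm q 0 (2 * n) * CSum (eterm q 0) = g n * CSum (eterm q n)).
  { induction n as [|n IH]; [change (1 * CSum (eterm q 0) = 1 * CSum (eterm q 0)); reflexivity |].
    replace (2 * S n)%nat with (S (S (2 * n))) by lia.
    unfold hterm; cbn [cprod]; fold (hterm q 0 (2 * n)).
    change (g (S n)) with (g n * (q ^ (4 * n + 3) / (1 + q ^ (2 * n + 2)))).
    match goal with |- ?h * ?x * ?y * ?e = _ => replace (h * x * y * e) with (h * e * x * y) by ring end.
    rewrite IH, (esum_rec q n Hq).
    rewrite Nat.mul_0_r, !Nat.add_0_r, !Nat.add_0_l.
    replace (S (2 * n) + 1)%nat with (2 * n + 2)%nat by lia.
    replace (S (S (2 * n)))%nat with (2 * n + 2)%nat by lia.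
    replace (S (2 * n))%nat with (2 * n + 1)%nat by lia.
    pose proof (one_plus_pow_neq_0 q (2 * n + 1) Hq) as H1.
    pose proof (one_plus_pow_neq_0 q (2 * n + 2) Hq) as H2.
    expand_powers_in H1; expand_powers_in H2; expand_powers.
    field; split; assumption. }
  assert (Hser : is_series (fun n => g n * CSum (eterm q (S n))) (2 * CSum (tterm q 0 0))).
  (* The tails are read off from [tsum_rec_diag]; at n = 0 the factor 1 + q^0 produces the 2. *)
  { apply (is_series_remainder (Cmod q) _ (fun n => (1 + q ^ (2 * n)) * CSum (tterm q n n) * g n));
      [lra | | |].
    - change ((1 + 1) * CSum (tterm q 0 0) * 1 = 2 * CSum (tterm q 0 0)).
      rewrite RtoC_2; ring.
    - intros n; rewrite (tsum_rec_diag q n Hq).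
      change (g (S n)) with (g n * (q ^ (4 * n + 3) / (1 + q ^ (2 * n + 2)))).
      replace (2 * S n)%nat with (2 * n + 2)%nat by ring.
      field; now apply one_plus_pow_neq_0.
    - apply geo_mult_bounded
        with (B := (2 * (/ (1 - Cmod q) * cprod_bound (Cmod q) / (1 - Cmod q)))%R); [lra | |].
      + intros n; rewrite Cmod_mult; apply Rmult_le_compat; try apply Cmod_ge_0.
        * apply Rle_trans with (1 := Cmod_triangle _ _); rewrite Cmod_1.
          pose proof (Cmod_pow_le_1 q (2 * n) Hq); lra.
        * apply CSum_Cmod_le; [lra | intros k; now apply tterm_Cmod_le].
      + exists (cprod_bound (Cmod q)); intros n.
        apply (cprod_geo_bounded (Cmod q) (fun i => q ^ (4 * i + 3)) (fun i => 1 + q ^ (2 * i + 2)));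
          [lra | apply near_1_pow; [exact Hq | lia] |].
        intros k; rewrite Cmod_pow; replace (4 * k + 3)%nat with (S (4 * k + 2)) by lia.
        apply pow_S_bounds; lra. }
  apply (is_series_C_unique _ _ _ Hser).
  pose proof (is_series_scal (CSum (eterm q 0)) _ _
    (is_series_pairs _ _ (CSum_correct (Cmod q) _ (conj Hr Hq) (hterm_geo q 0 Hq)))) as H.
  revert H; apply is_series_ext; intros n.
  change (CSum (eterm q 0) * (hterm q 0 (2 * n) + hterm q 0 (2 * n + 1)) =
    g n * CSum (eterm q (S n))).
  rewrite Nat.add_1_r; unfold hterm; cbn [cprod]; fold (hterm q 0 (2 * n)).
  match goal with |- ?e * (?h + ?h * ?x) = _ =>
    replace (e * (h + h * x)) with (h * e * (1 + x)) by ring end.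
  rewrite Hge, (esum_rec q n Hq), Nat.mul_0_r, Nat.add_0_r, Nat.add_0_l.
  replace (S (2 * n))%nat with (2 * n + 1)%nat by lia.
  field; now apply one_plus_pow_neq_0.
Qed.

(** The product is even, so the truncated division is exact. *)
Lemma pentagonal_double (n : nat) : (2 * (n * (3 * n + 1) / 2) = n * (3 * n + 1))%nat.
Proof.
  assert (He : exists e, (n * (3 * n + 1) = e * 2)%nat).
  { induction n as [|n [e He]]; [now exists 0%nat |].
    exists (e + 3 * n + 2)%nat; lia. }
  destruct He as [e ->]; rewrite Nat.div_mul; lia.
Qed.

Lemma hsum_series (q : C) :
  (Cmod q < 1)%R ->
  is_series (fun m : nat =>
    let n := S m in q ^ (n * (3 * n - 1) / 2) * (1 - q ^ n)) (1 - CSum (hterm q 0)).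
Proof.
  intros Hq; pose proof (Cmod_ge_0 q) as Hr.
  (* With e_n = n(3n+1)/2 the tail is (1 - H_n) q^(e_n). The next term of the series is q^(e_n+2n+1)
     - q^(e_n+3n+2), and e_(n+1) = e_n + 3n + 2, so [hsum_rec] is exactly the required step. *)
  apply (is_series_remainder (Cmod q) _
    (fun n => (1 - CSum (hterm q n)) * q ^ (n * (3 * n + 1) / 2))); [lra | | |].
  - simpl; ring.
  - intros n; cbn zeta.
    set (e := (n * (3 * n + 1) / 2)%nat).
    assert (He : (2 * e = n * (3 * n + 1))%nat) by apply pentagonal_double.
    replace (S n * (3 * S n - 1) / 2)%nat with (e + 2 * n + 1)%nat
      by (apply (Nat.div_unique _ 2 _ 0); lia).
    replace (S n * (3 * S n + 1) / 2)%nat with (e + 3 * n + 2)%nat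
      by (apply (Nat.div_unique _ 2 _ 0); lia).
    rewrite (hsum_rec q n Hq).
    replace (S n) with (n + 1)%nat by ring.
    replace (3 * n)%nat with (n + n + n)%nat by ring.
    expand_powers; ring.
  - apply geo_mult_bounded with (B := (1 + cprod_bound (Cmod q) / (1 - Cmod q))%R); [lra | |].
    + intros n; apply Rle_trans with (1 := Cmod_triangle _ _); rewrite Cmod_1, Cmod_opp.
      apply Rplus_le_compat_l, CSum_Cmod_le; [lra | intros j; now apply hterm_Cmod_le].
    + apply geo_pow; [exact Hq |]; intros n.
      pose proof (pentagonal_double n); nia.
Qed.

(** * The bounded solution F_k *)

(** Index 0 is set apart because F_0 is E_0 and not the sum of [fterm q 0]. *)
Definition cf_solution (q : C) (k : nat) : C :=
  match k with
  | O => CSum (eterm q 0)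
  | _ => if Nat.even k then CSum (fterm q (Nat.div2 k)) else CSum (gterm q (Nat.div2 k))
  end.

Lemma cf_solution_even (q : C) (n : nat) :
  cf_solution q (2 * S n) = CSum (fterm q (S n)).
Proof.
  unfold cf_solution; rewrite Nat.even_even, Nat.div2_even; reflexivity.
Qed.

Lemma cf_solution_odd (q : C) (n : nat) :
  cf_solution q (2 * n + 1) = CSum (gterm q n).
Proof.
  unfold cf_solution; rewrite Nat.even_odd, Nat.div2_odd'.
  now rewrite Nat.add_1_r.
Qed.

(** At n = 0 the two [pochp] cancel, and adding the summands cancels 1 + q^(2k). This extra copy of
    F_1 is why b_0 is 2 + q and not 1 + q. *)
Lemma fsum_gsum_0 (q : C) :
  (Cmod q < 1)%R -> CSum (eterm q 0) = CSum (fterm q 0) + CSum (gterm q 0).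
Proof.
  intros Hq.
  rewrite (CSum_telescope (Cmod q) (eterm q 0) (fterm q 0) (gterm q 0) (fun _ => 0) 1 1).
  - ring.
  - split; [apply Cmod_ge_0 | exact Hq].
  - now apply eterm_geo.
  - now apply fterm_geo.
  - now apply gterm_geo.
  - exists 0%R; intros; rewrite Cmod_0; lra.
  - intros k; unfold gterm, fterm, eterm; rewrite !Nat.mul_0_l, Nat.add_0_l, !Nat.mul_0_r.
    field; repeat split;
      first [now apply pochp_neq_0 | now apply pochm_neq_0 | now apply one_plus_pow_neq_0].
Qed.

Lemma gsum_tsum_0 (q : C) : (Cmod q < 1)%R -> CSum (gterm q 0) = CSum (tterm q 0 0).
Proof.
  intros Hq; apply CSum_ext; intros k.
  unfold gterm, fterm, tterm, eterm; rewrite !Nat.mul_0_l, !Nat.mul_0_r, !Nat.add_0_l.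
  field; repeat split;
    first [now apply pochp_neq_0 | now apply pochm_neq_0 | now apply one_plus_pow_neq_0].
Qed.

Lemma nat_zero_or_parity (k : nat) :
  k = 0%nat \/ (exists n, k = (2 * n + 1)%nat) \/ (exists n, k = (2 * S n)%nat).
Proof.
  destruct (Nat.Even_or_Odd k) as [[[|n] Hn]|[n Hn]]; eauto.
Qed.

Lemma cf_solution_bounded (q : C) (k : nat) :
  (Cmod q < 1)%R ->
  (Cmod (cf_solution q k) <=
     (cprod_bound (Cmod q) + fterm_bound (Cmod q)) / (1 - Cmod q))%R.
Proof.
  intros Hq; pose proof (Cmod_ge_0 q).
  assert (Hc : (0 <= cprod_bound (Cmod q))%R) by (left; apply exp_pos).
  assert (Hf : (0 <= fterm_bound (Cmod q))%R).
  { apply Rmult_le_pos; [left; apply Rinv_0_lt_compat; lra | now apply pow_le]. }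
  (* The slack [N] lets one constant serve all three cases. *)
  assert (Hs : forall M N a, (forall i, (Cmod (a i) <= M * Cmod q ^ i)%R) ->
     (0 <= N)%R -> (Cmod (CSum a) <= (M + N) / (1 - Cmod q))%R).
  { intros M N a Ha HN; apply CSum_Cmod_le; [lra |].
    intros i; apply Rle_trans with (1 := Ha i).
    apply Rmult_le_compat_r; [apply pow_le; lra | lra]. }
  destruct (nat_zero_or_parity k) as [-> | [[n ->] | [n ->]]].
  - apply Hs; [| exact Hf].
    intros i; apply Rle_trans with (1 := eterm_Cmod_le q 0 i Hq).
    apply Rmult_le_compat_l, pow_le_pow_base_lt1; [exact Hc | lra | nia].
  - rewrite cf_solution_odd, Rplus_comm; apply Hs; [| exact Hc].
    intros i; now apply gterm_Cmod_le.
  - rewrite cf_solution_even, Rplus_comm; apply Hs; [| exact Hc].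
    intros i; now apply fterm_Cmod_le.
Qed.

(** * Convergence of the continued fraction to the false theta series *)

Theorem corollary2p6 (q : C) (a b : nat -> C)
  (hq0 : q <> 0)
  (hq1 : (Cmod q < 1)%R)
  (hb0 : b 0%nat = 2 + q)
  (hb : forall k : nat, (1 <= k)%nat -> b k = 1 + q ^ (2 * k + 1))
  (ha_odd : forall n : nat, (1 <= n)%nat ->
     a (2 * n - 1)%nat = q ^ (4 * n - 3) - q ^ (6 * n - 3))
  (ha_even : forall n : nat, (1 <= n)%nat ->
     a (2 * n)%nat = q ^ (2 * n) + q ^ (4 * n - 1)) :
  exists s : C,
    is_series (fun m : nat =>
      let n := S m in q ^ (n * (3 * n - 1) / 2) * (1 - q ^ n)) s /\
    cf_has_value 2 a b (Some (1 - s)).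
Proof.
  pose proof (Cmod_ge_0 q) as Hr.
  exists (1 - CSum (hterm q 0)); split; [now apply hsum_series |].
  (* Shifting n by one removes the truncated subtractions; the factored form serves both the bound
     and the nonvanishing. *)
  assert (Hodd : forall n, a (2 * n + 1)%nat = q ^ (4 * n + 1) * (1 - q ^ (2 * n + 2))).
  { intros n; replace (2 * n + 1)%nat with (2 * S n - 1)%nat by lia.
    rewrite ha_odd by lia.
    replace (4 * S n - 3)%nat with (4 * n + 1)%nat by lia.
    replace (6 * S n - 3)%nat with ((4 * n + 1) + (2 * n + 2))%nat by lia.
    rewrite (Cpow_add_r q (4 * n + 1)); ring. }
  assert (Heven : forall n, a (2 * S n)%nat = q ^ (2 * n + 2) * (1 + q ^ (2 * n + 1))).
  { intros n; rewrite ha_even by lia.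
    replace (2 * S n)%nat with (2 * n + 2)%nat by lia.
    replace (4 * S n - 1)%nat with ((2 * n + 2) + (2 * n + 1))%nat by lia.
    rewrite (Cpow_add_r q (2 * n + 2)); ring. }
  assert (Ha_bound : forall k, (Cmod (a (S k)) <= 2 * Cmod q ^ k)%R).
  { intros k.
    destruct (Nat.Even_or_Odd k) as [[n ->]|[n ->]].
    - rewrite <- Nat.add_1_r, Hodd, Cmod_mult, Cmod_pow, Rmult_comm.
      apply Rmult_le_compat; [apply Cmod_ge_0 | now apply pow_le | |
        apply pow_le_pow_base_lt1; [lra | lia]].
      apply Rle_trans with (1 := Cmod_triangle _ _); rewrite Cmod_1, Cmod_opp.
      pose proof (Cmod_pow_le_1 q (2 * n + 2) hq1); lra.
    - replace (S (2 * n + 1)) with (2 * S n)%nat by lia.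
      rewrite Heven, Cmod_mult, Cmod_pow, Rmult_comm.
      apply Rmult_le_compat; [apply Cmod_ge_0 | now apply pow_le | |
        apply pow_le_pow_base_lt1; [lra | lia]].
      apply Rle_trans with (1 := Cmod_triangle _ _); rewrite Cmod_1.
      pose proof (Cmod_pow_le_1 q (2 * n + 1) hq1); lra. }
  assert (Ha_neq : forall k, (1 <= k)%nat -> a k <> 0).
  { intros k Hk; destruct (nat_zero_or_parity k) as [-> | [[n ->] | [n ->]]]; [lia | |].
    - rewrite Hodd; apply Cmult_neq_0; [now apply Cpow_nz |].
      apply one_minus_pow_neq_0; [exact hq1 | lia].
    - rewrite Heven; apply Cmult_neq_0; [now apply Cpow_nz | now apply one_plus_pow_neq_0]. }
  assert (H2 : RtoC 2 <> 0) by (intros H; apply RtoC_inj in H; lra).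
  split; [exact H2 | split; [exact Ha_neq |]].
  (* The value 1 - s is H_0, which equals 2 F_1 / F_0. *)
  replace (1 - (1 - CSum (hterm q 0)))
    with (2 * cf_solution q 1 / cf_solution q 0).
  2:{ change (cf_solution q 1) with (CSum (gterm q 0)).
      change (cf_solution q 0) with (CSum (eterm q 0)).
      rewrite (gsum_tsum_0 q hq1), (two_tsum_eq_esum_hsum q hq1).
      field; now apply esum_neq_0. }
  (* The 4 is dictated by k = 0, where |2 + q| + |a_1| is at most 5 = 1 + 4; for k >= 1 the sum is
     at most 1 + 3 |q|^k. The 2 is the constant of [Ha_bound]. *)
  apply (cf_approximant_cvg (Cmod q) 4 2
    ((cprod_bound (Cmod q) + fterm_bound (Cmod q)) / (1 - Cmod q)));
    [lra | lra | exact Ha_neq | | | exact Ha_bound | | now apply esum_neq_0].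
  - intros k; destruct (nat_zero_or_parity k) as [-> | [[n ->] | [n ->]]].
    (* E_0 is the sum of [fterm q 0] plus F_1, and [fsum_rec] at 0 expands the former as (1 + q) F_1
       + a_1 F_2. *)
    + change (cf_solution q 0) with (CSum (eterm q 0)).
      change (cf_solution q 1) with (CSum (gterm q 0)).
      change (cf_solution q 2) with (CSum (fterm q 1)).
      change (a 1%nat) with (a (2 * 0 + 1)%nat).
      rewrite hb0, (Hodd 0%nat), (fsum_gsum_0 q hq1), (fsum_rec q 0 hq1).
      rewrite RtoC_2; simpl; ring.
    + replace (S (2 * n + 1)) with (2 * S n)%nat by lia.
      replace (S (2 * S n)) with (2 * S n + 1)%nat by lia.
      rewrite cf_solution_even, !cf_solution_odd, Heven, hb by lia.
      replace (2 * (2 * n + 1) + 1)%nat with (4 * n + 3)%nat by lia.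
      rewrite (gsum_rec q n hq1).
      expand_powers; ring.
    + replace (S (2 * S n)) with (2 * S n + 1)%nat by lia.
      replace (S (2 * S n + 1)) with (2 * S (S n))%nat by lia.
      rewrite !cf_solution_even, cf_solution_odd, Hodd, hb by lia.
      replace (2 * (2 * S n) + 1)%nat with (4 * S n + 1)%nat by lia.
      apply fsum_rec, hq1.
  - intros [|k].
    + rewrite hb0; pose proof (Ha_bound 0%nat) as H; simpl in H |- *.
      pose proof (Cmod_triangle 2 q) as H'; rewrite Cmod_R, Rabs_pos_eq in H' by lra; lra.
    + rewrite hb by lia; pose proof (Ha_bound (S k)) as H.
      pose proof (Cmod_triangle 1 (q ^ (2 * S k + 1))) as H'.
      rewrite Cmod_1, Cmod_pow in H'.
      pose proof (pow_le_pow_base_lt1 (Cmod q) (S k) (2 * S k + 1) ltac:(lra) ltac:(lia)).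
      assert (0 <= Cmod q ^ S k)%R by now apply pow_le.
      lra.
  - intros k; now apply cf_solution_bounded.
Qed.
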